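(* Let $\Sigma=\{1,\dots,d\}$ be a finite alphabet, let $\mathcal T=\Sigma^*$ be the associated regular rooted tree, and let $G<\mathrm{Aut}(\mathcal T)$ be a discrete group that is fractal and weakly branch. Then there are uncountably many pairwise inequivalent irreducible representations of the form $\rho_{G/P}$, where $P$ is a parabolic subgroup of $G$.
   Context: The vertices of $\mathcal T=\Sigma^*$ are the finite words over $\Sigma$; the root is the empty word and the children of $\sigma$ are the words $\sigma s$, $s\in\Sigma$. $\mathrm{Aut}(\mathcal T)$ is the group of automorphisms of this rooted tree. All groups considered are spherically transitive: $G$ acts transitively on $\Sigma^n$ for every $n\in\mathbb N$. If $g\in\mathrm{Aut}(\mathcal T)$ fixes the word $\sigma$, then $g_{|\sigma}\in\mathrm{Aut}(\mathcal T)$ is defined by $g(\sigma\tau)=\sigma\,g_{|\sigma}(\tau)$. $\mathrm{Stab}_G(\sigma)$ is the stabilizer of $\sigma$ in $G$. $G$ is fractal if for every vertex $\sigma$ one has $\{g_{|\sigma}: g\in\mathrm{Stab}_G(\sigma)\}\cong G$, where the isomorphism is the one induced by the identification of $\mathcal T$ with the subtree rooted at $\sigma$. For $g\in\mathrm{Aut}(\mathcal T)$, let $g^\sigma$ be the automorphism with $g^\sigma(\sigma\tau)=\sigma g(\tau)$ and $g^\sigma(\tau)=\tau$ if $\tau$ does not begin with $\sigma$. The rigid stabilizer of $\sigma$ is $\mathrm{Rist}_G(\sigma)=\{g^\sigma: g\in G\}\cap G$. $G$ is weakly branch if $\mathrm{Rist}_G(\sigma)$ is infinite for every vertex $\sigma$.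 A parabolic subgroup of $G$ is the stabilizer $P=\mathrm{Stab}_G(e)$ of a ray $e\in\Sigma^{\mathbb N}$ (an infinite geodesic starting at the root). For a subgroup $H$ of the discrete group $G$, $\rho_{G/H}$ is the quasi-regular representation of $G$ on $\ell^2(G/H)$.
   Formalization: ''Discrete group'' is taken to mean countable discrete group; without countability the claim fails, e.g. for G = Aut(T) with d ≥ 2, which is transitive on rays, so all its representations ρ_{G/P} are equivalent. *)

(* Defs.v *)
From HB Require Import structures.
From mathcomp Require Import all_boot all_order all_algebra.
From mathcomp Require Import all_classical all_reals all_analysis.
From mathcomp Require Import complex.
From mathcomp Require Import ring.

Set Implicit Arguments.
Unset Strict Implicit.
Unset Printing Implicit Defensive.

Import Order.TTheory GRing.Theory Num.Theory.
Import numFieldNormedType.Exports.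

Local Open Scope classical_set_scope.
Local Open Scope ring_scope.

Record subgroup_type (gT : groupType) (H : groupClosed gT) : Type :=
  SubgroupType { subgroup_val :> gT; _ : subgroup_val \in H }.

Section SubgroupType.
Variables (gT : groupType) (H : groupClosed gT).

HB.instance Definition _ := [isSub for @subgroup_val gT H].
HB.instance Definition _ := [Choice of subgroup_type H by <:].

Fact subgroup_group_closed : group_closed H.
Proof. by split=> [|x y xH yH]; [exact: gpred1 | exact: gpredF]. Qed.

HB.instance Definition _ := SubChoice_isSubGroup.Build gT _
  (subgroup_type H) subgroup_group_closed.

End SubgroupType.

Section Ell2Sum.
Variables (R : realType) (X : choiceType).
Implicit Types f g : X -> R[i].
Local Notation normc := Normc.normc.

Definition ell2_sum f : \bar R :=
  (\esum_(x in [set: X]) (normc (f x) ^+ 2)%:E)%E.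

Let normc_ge0 (z : R[i]) : 0 <= normc z.
Proof. by case: z => a b; exact: sqrtr_ge0. Qed.

Lemma ell2_sum_ge0 f : (0 <= ell2_sum f)%E.
Proof. by apply: esum_ge0 => x _; rewrite lee_fin sqr_ge0. Qed.

Lemma ell2_sum0 : ell2_sum 0 = 0%E.
Proof. by apply: esum1 => x _; rewrite Normc.normc0 expr0n. Qed.

Lemma ell2_sum_eq0 f : ell2_sum f = 0%E -> f = 0.
Proof.
move=> f0; apply/funext => x; apply: Normc.eq0_normc; apply/eqP.
rewrite -sqrf_eq0 eq_le sqr_ge0 andbT -lee_fin.
change ((normc (f x) ^+ 2)%:E <= 0)%E; rewrite -f0.
apply: esum_ge; exists [set x]; first by split => //; exact: finite_set1.
by rewrite fsbig_set1.
Qed.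

Let ell2_sumZ_le c f : (ell2_sum (c *: f) <= (normc c ^+ 2)%:E * ell2_sum f)%E.
Proof.
apply: ge_ereal_sup => _ [F [finF _] <-].
under eq_fsbigr do rewrite /= Normc.normcM exprMn EFinM.
rewrite -ge0_mule_fsumr; last by move=> x; rewrite lee_fin sqr_ge0.
apply: lee_wpmul2l; first by rewrite lee_fin sqr_ge0.
by apply: esum_ge; exists F.
Qed.

Lemma ell2_sumZ c f : ell2_sum (c *: f) = ((normc c ^+ 2)%:E * ell2_sum f)%E.
Proof.
have [->|c0] := eqVneq c 0.
  by rewrite scale0r ell2_sum0 Normc.normc0 expr0n mul0e.
apply/eqP; rewrite eq_le ell2_sumZ_le /=.
have nc0 : 0 < normc c ^+ 2.
  rewrite lt_neqAle sqr_ge0 andbT eq_sym sqrf_eq0.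
  by apply: contraNneq c0 => /Normc.eq0_normc ->.
rewrite muleC -lee_pdivlMr// -{1}[f]scale1r -(mulVf c0) -scalerA.
by rewrite (le_trans (ell2_sumZ_le _ _))// Normc.normcV exprVn muleC.
Qed.

Lemma ell2_sumD_le (t : R) f g : 0 < t ->
  (ell2_sum (f + g)%R <=
   (1 + t)%:E * ell2_sum f + (1 + t^-1)%:E * ell2_sum g)%E.
Proof.
move=> t0; have ti0 : 0 < t^-1 by rewrite invr_gt0.
have nq (s : R) : 0 < s -> normc (Num.sqrt (1 + s))%:C%C ^+ 2 = 1 + s.
  move=> s0; rewrite /normc /= expr0n addr0 sqrtr_sqr.
  by rewrite ger0_norm ?sqrtr_ge0// sqr_sqrtr// addr_ge0// ltW.
rewrite -(nq t t0) -(nq _ ti0) -!ell2_sumZ -esumD; last 2 first.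
- by move=> x _; rewrite lee_fin sqr_ge0.
- by move=> x _; rewrite lee_fin sqr_ge0.
apply: le_esum => x _; rewrite -EFinD lee_fin /= !Normc.normcM !exprMn !nq//.
set a := normc (f x); set b := normc (g x).
have a0 : 0 <= a by exact: normc_ge0.
have b0 : 0 <= b by exact: normc_ge0.
apply: (@le_trans _ _ ((a + b) ^+ 2)).
  rewrite lerXn2r ?nnegrE ?addr_ge0 ?normc_ge0//.
  have nE (z : R[i]) : `|z| = (normc z)%:C%C by [].
  by have := ler_normD (f x) (g x); rewrite !nE -rmorphD lecR.
rewrite -subr_ge0.
have -> : (1 + t) * a ^+ 2 + (1 + t^-1) * b ^+ 2 - (a + b) ^+ 2
   = t * (a - t^-1 * b) ^+ 2.
  by field; rewrite gt_eqF.
by rewrite mulr_ge0 ?sqr_ge0// ltW.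
Qed.
End Ell2Sum.

Definition ell2_pred (R : realType) (X : choiceType) : {pred X -> R[i]} :=
  [pred f | `[< (ell2_sum f < +oo)%E >]].

Fact ell2_submod_closed (R : realType) (X : choiceType) :
  GRing.submod_closed (@ell2_pred R X).
Proof.
split=> [|c f g /asboolP f2 /asboolP g2]; apply/asboolP.
  by rewrite ell2_sum0 ltry.
apply: le_lt_trans (ell2_sumD_le _ _ ltr01) _.
rewrite ell2_sumZ; apply: lte_add_pinfty; apply: lte_mul_pinfty => //.
by apply: lte_mul_pinfty; rewrite ?lee_fin ?sqr_ge0.
Qed.

HB.instance Definition _ (R : realType) (X : choiceType) :=
  GRing.isSubmodClosed.Build R[i] (X -> R[i]) (@ell2_pred R X)
    (ell2_submod_closed R X).

Record ell2 (R : realType) (X : choiceType) : Type :=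
  Ell2 { ell2_fun :> X -> R[i]; _ : ell2_fun \in @ell2_pred R X }.

Section Ell2.
Variables (R : realType) (X : choiceType).
Implicit Types f g : ell2 R X.

HB.instance Definition _ := [isSub for @ell2_fun R X].
HB.instance Definition _ := [Choice of ell2 R X by <:].
HB.instance Definition _ := [SubChoice_isSubLmodule of ell2 R X by <:].

Definition ell2_norm f : R[i] := (Num.sqrt (fine (ell2_sum f)))%:C%C.

Let ell2_fin f : ell2_sum f \is a fin_num.
Proof.
rewrite ge0_fin_numE ?ell2_sum_ge0//.
by case: f => f /= /asboolP.
Qed.

Fact ell2_norm_eq0 f : ell2_norm f = 0 -> f = 0.
Proof.
case=> /eqP; rewrite sqrtr_eq0 => f0; apply/val_inj/ell2_sum_eq0.
rewrite -[LHS]fineK ?ell2_fin//; congr EFin; apply/eqP.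
by rewrite eq_le f0 fine_ge0// ell2_sum_ge0.
Qed.

Fact ell2_normZ (c : R[i]) f : ell2_norm (c *: f) = `|c| * ell2_norm f.
Proof.
have nE (z : R[i]) : `|z| = (Normc.normc z)%:C%C by [].
rewrite /ell2_norm nE -rmorphM; congr (_%:C)%C.
rewrite (_ : ell2_sum (c *: f) = ell2_sum (c *: (f : X -> R[i])))//.
rewrite ell2_sumZ fineM ?ell2_fin//= sqrtrM ?sqr_ge0// sqrtr_sqr ger0_norm//.
by case: (c) => a b; exact: sqrtr_ge0.
Qed.

Fact ell2_normD f g : ell2_norm (f + g) <= ell2_norm f + ell2_norm g.
Proof.
rewrite /ell2_norm -rmorphD lecR.
have [f0|f0] := eqVneq (ell2_norm f) 0.
  by rewrite (ell2_norm_eq0 f0) add0r lerDr sqrtr_ge0.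
have [g0|g0] := eqVneq (ell2_norm g) 0.
  by rewrite (ell2_norm_eq0 g0) addr0 lerDl sqrtr_ge0.
have sq (h : ell2 R X) : fine (ell2_sum h) = Num.sqrt (fine (ell2_sum h)) ^+ 2.
  by rewrite sqr_sqrtr// fine_ge0// ell2_sum_ge0.
have pos h : ell2_norm h != 0 -> 0 < Num.sqrt (fine (ell2_sum h)).
  move=> h0; rewrite lt_neqAle sqrtr_ge0 andbT eq_sym.
  by apply: contraNneq h0; rewrite /ell2_norm => ->.
move: (pos f f0) (pos g g0) (sq f) (sq g).
set a := Num.sqrt (fine (ell2_sum f)); set b := Num.sqrt (fine (ell2_sum g)).
move=> a0 b0 fa gb.
rewrite -(@ler_pXn2r _ 2)// ?nnegrE ?sqrtr_ge0 ?addr_ge0 ?(ltW a0) ?(ltW b0)// -sq.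
rewrite -lee_fin fineK//.
have := @ell2_sumD_le R X (b / a) f g (divr_gt0 b0 a0).
rewrite -(fineK (ell2_fin f)) -(fineK (ell2_fin g)) fa gb => /le_trans; apply.
rewrite -!EFinM -EFinD lee_fin.
rewrite le_eqVlt; apply/orP; left; apply/eqP.
by field; rewrite !gt_eqF.
Qed.

HB.instance Definition _ := @Lmodule_isNormed.Build R[i] (ell2 R X)
  ell2_norm ell2_normD ell2_normZ ell2_norm_eq0.

Lemma ell2_normE f : `|f| = ell2_norm f. Proof. by []. Qed.

End Ell2.

Record unitary_rep (R : realType) (G : groupType) (V : normedModType R[i]) :=
  UnitaryRep {
    rep_fun :> G -> {linear V -> V};
    rep1 : forall v, rep_fun 1%g v = v;
    repM : forall g h v, rep_fun (g * h)%g v = rep_fun g (rep_fun h v);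
    rep_norm : forall g v, `|rep_fun g v| = `|v| }.

Definition irreducible (R : realType) (G : groupType) (V : normedModType R[i])
    (rho : unitary_rep G V) : Prop :=
  (exists v : V, v != 0) /\
  forall W : set V, GRing.submod_closed [pred v | v \in W] -> closed W ->
    (forall g v, W v -> W (rho g v)) -> W = [set 0] \/ W = [set: V].

(* On Hilbert spaces, a unitary operator is a surjective linear isometry. *)
Definition unitarily_equivalent (R : realType) (G : groupType)
    (V1 V2 : normedModType R[i]) (rho1 : unitary_rep G V1)
    (rho2 : unitary_rep G V2) : Prop :=
  exists U : {linear V1 -> V2},
    [/\ forall v, `|U v| = `|v|,
        forall w, exists v, U v = w
      & forall g v, U (rho1 g v) = rho2 g (U v)].

Section QuasiRegular.
Variables (R : realType) (gT : groupType) (H : groupClosed gT).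
Implicit Types g x : gT.

Definition left_coset g : set gT := [set (g * h)%g | h in [set` H]].

Definition coset_space : Type := set_type (range left_coset).
HB.instance Definition _ := Choice.on coset_space.

Fact coset_act_subproof g (A : coset_space) :
  [set (g * x)%g | x in val A] \in range left_coset.
Proof.
case: A => /= A /set_mem[k _ <-]; apply/mem_set; exists (g * k)%g => //.
apply/seteqP; split=> [_ [h Hh <-]|_ [_ [h Hh <-] <-]].
  by exists (k * h)%g; [exists h | rewrite mulgA].
by exists h; rewrite ?mulgA.
Qed.

Definition coset_act g (A : coset_space) : coset_space :=
  exist _ [set (g * x)%g | x in val A] (coset_act_subproof g A).

Lemma coset_act1 A : coset_act 1%g A = A.
Proof.
apply/val_inj/seteqP; split=> [_ [x Ax <-]|x Ax] /=; first by rewrite mul1g.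
by exists x; rewrite ?mul1g.
Qed.

Lemma coset_actM g h A : coset_act (g * h)%g A = coset_act g (coset_act h A).
Proof.
apply/val_inj/seteqP; split=> [_ [x Ax <-]|_ [_ [x Ax <-] <-]] /=.
  by exists (h * x)%g; [exists x | rewrite mulgA].
by exists x; rewrite ?mulgA.
Qed.

Notation V := (ell2 R coset_space).

Fact quasi_regular_sum g (f : coset_space -> R[i]) :
  ell2_sum (f \o coset_act g) = ell2_sum f.
Proof.
rewrite [RHS](reindex_esum [set: coset_space] _ (coset_act g))//.
split=> // [A B _ _ gAB|A _].
  by rewrite -[A]coset_act1 -(mulVg g) coset_actM gAB -coset_actM mulVg coset_act1.
by exists (coset_act g^-1 A) => //; rewrite -coset_actM mulgV coset_act1.
Qed.

Fact quasi_regular_subproof g (f : V) :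
  (f : coset_space -> R[i]) \o coset_act g^-1 \in @ell2_pred R coset_space.
Proof. by apply/asboolP; rewrite quasi_regular_sum; case: f => f /= /asboolP. Qed.

Definition quasi_regular_fun g (f : V) : V :=
  Ell2 (quasi_regular_subproof g f).

Fact quasi_regular_linear g : linear (quasi_regular_fun g).
Proof. by move=> c f1 f2; apply/val_inj. Qed.

HB.instance Definition _ g := GRing.isLinear.Build R[i] V V *:%R
  (quasi_regular_fun g) (quasi_regular_linear g).

Fact quasi_regular1 f : quasi_regular_fun 1%g f = f.
Proof. by apply/val_inj/funext => A /=; rewrite invg1 coset_act1. Qed.

Fact quasi_regularM g h f :
  quasi_regular_fun (g * h)%g f = quasi_regular_fun g (quasi_regular_fun h f).
Proof. by apply/val_inj/funext => A /=; rewrite invgM coset_actM. Qed.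

Fact quasi_regular_norm g f : `|quasi_regular_fun g f| = `|f|.
Proof. by rewrite !ell2_normE /ell2_norm quasi_regular_sum. Qed.

Definition quasi_regular : unitary_rep gT V :=
  @UnitaryRep R gT V (fun g => quasi_regular_fun g) quasi_regular1
    quasi_regularM quasi_regular_norm.

End QuasiRegular.

Section Tree.
Variable d : nat.
Notation word := (seq 'I_d).

Definition is_child (s t : word) : bool := [exists x, t == rcons s x].

Definition tree_automorphism (f : word -> word) : Prop :=
  [/\ bijective f, f [::] = [::]
    & forall s t, is_child (f s) (f t) = is_child s t].

Record tree_aut : Type :=
  TreeAut { tree_aut_fun :> word -> word; _ : `[< tree_automorphism tree_aut_fun >] }.

HB.instance Definition _ := [isSub for tree_aut_fun].
HB.instance Definition _ := [Choice of tree_aut by <:].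

Implicit Types g h : tree_aut.

Lemma tree_autP g : tree_automorphism g.
Proof. by case: g => f /= /asboolP. Qed.

Fact tree_aut1_subproof : `[< tree_automorphism id >].
Proof. by apply/asboolP; split=> //; exists id. Qed.

Fact tree_autM_subproof g h : `[< tree_automorphism (g \o h) >].
Proof.
have [[bg g0 gc] [bh h0 hc]] := (tree_autP g, tree_autP h).
apply/asboolP; split; first exact: bij_comp.
  by rewrite /= h0.
by move=> s t; rewrite /= gc hc.
Qed.

Fact tree_aut_inv_exists g : exists f, cancel f g /\ cancel g f.
Proof. by have [[f ? ?] _ _] := tree_autP g; exists f. Qed.

Definition tree_aut_inv_fun g : word -> word := sval (cid (tree_aut_inv_exists g)).

Fact tree_aut_invK g : cancel (tree_aut_inv_fun g) g.
Proof. by rewrite /tree_aut_inv_fun; case: cid => f []. Qed.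

Fact tree_aut_funK g : cancel g (tree_aut_inv_fun g).
Proof. by rewrite /tree_aut_inv_fun; case: cid => f []. Qed.

Fact tree_autV_subproof g : `[< tree_automorphism (tree_aut_inv_fun g) >].
Proof.
have [_ g0 gc] := tree_autP g; apply/asboolP; split.
- by exists g; [exact: tree_aut_invK | exact: tree_aut_funK].
- by rewrite -{1}g0 tree_aut_funK.
- by move=> s t; rewrite -gc !tree_aut_invK.
Qed.

Definition tree_aut1 := TreeAut tree_aut1_subproof.
Definition tree_autM g h := TreeAut (tree_autM_subproof g h).
Definition tree_autV g := TreeAut (tree_autV_subproof g).

Fact tree_autMA : associative tree_autM.
Proof. by move=> f g h; apply/val_inj. Qed.
Fact tree_aut1M : left_id tree_aut1 tree_autM.
Proof. by move=> f; apply/val_inj. Qed.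
Fact tree_autM1 : right_id tree_aut1 tree_autM.
Proof. by move=> f; apply/val_inj. Qed.
Fact tree_autVM : left_inverse tree_aut1 tree_autV tree_autM.
Proof. by move=> f; apply/val_inj/funext => s; exact: tree_aut_funK. Qed.
Fact tree_autMV : right_inverse tree_aut1 tree_autV tree_autM.
Proof. by move=> f; apply/val_inj/funext => s; exact: tree_aut_invK. Qed.

HB.instance Definition _ := isGroup.Build tree_aut
  tree_autMA tree_aut1M tree_autM1 tree_autVM tree_autMV.

End Tree.

Section Subgroups.
Variables (d : nat) (G : groupClosed (tree_aut d)).
Notation word := (seq 'I_d).

Definition spherically_transitive : Prop :=
  forall (n : nat) (s t : n.-tuple 'I_d), exists2 g, g \in G & g s = t.

Definition vertex_stab (s : word) : set (tree_aut d) :=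
  [set g | g \in G /\ g s = s].

(* h is the section g_{|s}; it is unique, and exists when g fixes s. *)
Definition is_section (g : tree_aut d) (s : word) (h : tree_aut d) : Prop :=
  forall t, g (s ++ t) = s ++ h t.

Definition fractal : Prop :=
  forall s : word,
    [set h | exists2 g, vertex_stab s g & is_section g s h] = [set` G].

(* The map underlying the automorphism g^s that acts as g below s and
   trivially elsewhere. *)
Definition graft (s : word) (g : tree_aut d) (t : word) : word :=
  if prefix s t then s ++ g (drop (size s) t) else t.

Definition rigid_stab (s : word) : set (tree_aut d) :=
  [set h | h \in G /\ exists2 g, g \in G & h =1 graft s g].

Definition weakly_branch : Prop := forall s : word, infinite_set (rigid_stab s).

(* A ray is encoded by its sequence of letters; its vertices are the prefixes
   [mkseq e n], and an automorphism fixes the ray iff it fixes all of them. *)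
Definition fixes_ray (e : nat -> 'I_d) : {pred subgroup_type G} :=
  [pred g : subgroup_type G | `[< forall n, (val g : tree_aut d) (mkseq e n) = mkseq e n >]].

Fact fixes_ray_inv e : invg_closed (fixes_ray e).
Proof.
move=> g /asboolP ge; apply/asboolP => n.
by rewrite -{1}(ge n) /=; exact: tree_aut_funK.
Qed.

Fact fixes_ray_1 e : 1%g \in fixes_ray e.
Proof. by apply/asboolP. Qed.

Fact fixes_ray_mul e : mulg_closed (fixes_ray e).
Proof.
move=> g h /asboolP ge /asboolP he; apply/asboolP => n.
by rewrite /= /tree_autM /= he ge.
Qed.

HB.instance Definition _ e := isMulClosed.Build (subgroup_type G)
  (fixes_ray e) (@fixes_ray_mul e).
HB.instance Definition _ e := isMul1Closed.Build (subgroup_type G)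
  (fixes_ray e) (@fixes_ray_1 e).
HB.instance Definition _ e := isInvClosed.Build (subgroup_type G)
  (fixes_ray e) (@fixes_ray_inv e).

Definition parabolic (e : nat -> 'I_d) : groupClosed (subgroup_type G) :=
  GroupClosed.clone (subgroup_type G) (fixes_ray e) _.

End Subgroups.

Arguments quasi_regular R {gT} H.
Arguments parabolic {d} G e.

(* Main.v *)
(* Mackey's criterion: [rho_{G/H}] is irreducible as soon as every H-orbit on
   G/H other than the base point is infinite.  If W is a nonzero closed invariant
   subspace, it contains vectors v with v(H) = 1; by the parallelogram identity
   those of nearly minimal norm are close to one another, hence nearly
   H-invariant, hence pointwise close to [delta_H], because an l^2 vector is small
   somewhere on each infinite orbit.  So they converge to [delta_H], which lies in
   W and generates l^2(G/H).  Likewise, an intertwiner from [rho_{G/H}] to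
   [rho_{G/K}] sends [delta_H] to an H-invariant vector, which vanishes when all
   H-orbits on G/K are infinite.

   For H = Stab(e) and a ray f <> e, let s be a prefix of f that is not a prefix of
   e: Rist(s) fixes e, so the orbit of f under H is infinite as soon as the orbits
   of { k : k^s in G } on the levels of the tree are unbounded.  By fractality this
   group is normal in G, so all its orbits on a level have the same size, and this
   size keeps growing because the group contains elements fixing a given vertex and
   moving something below it.  Finally take one ray in each G-orbit: G being
   countable, there are uncountably many orbits. *)
Require Import Defs.
From mathcomp Require Import all_boot all_order all_algebra.
From mathcomp Require Import all_classical all_reals all_analysis.
From mathcomp Require Import complex finmap ring lra.

Set Implicit Arguments.
Unset Strict Implicit.
Unset Printing Implicit Defensive.

Import Order.TTheory GRing.Theory Num.Theory.
Import numFieldNormedType.Exports.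

Local Open Scope classical_set_scope.
Local Open Scope ring_scope.

(** * Square-summable functions *)

Section Ell2Vectors.
Variables (R : realType) (X : choiceType).
Implicit Types (f g : ell2 R X) (s t : seq X) (x y : X).

Definition sqmod (z : R[i]) : R := Normc.normc z ^+ 2.

Lemma sqmodE a b : sqmod (a +i* b)%C = a ^+ 2 + b ^+ 2.
Proof. by rewrite /sqmod /= sqr_sqrtr// addr_ge0 ?sqr_ge0. Qed.

Lemma sqmod_ge0 z : 0 <= sqmod z. Proof. exact: sqr_ge0. Qed.

Lemma sqmod0 : sqmod 0 = 0.
Proof. by rewrite /sqmod Normc.normc0 expr0n. Qed.

Lemma sqmod1 : sqmod 1 = 1.
Proof. by rewrite sqmodE; ring. Qed.

Lemma sqmodN z : sqmod (- z) = sqmod z.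
Proof. by case: z => ? ?; rewrite !sqmodE !sqrrN. Qed.

Lemma sqmodM z w : sqmod (z * w) = sqmod z * sqmod w.
Proof. by rewrite /sqmod Normc.normcM exprMn. Qed.

Lemma sqmod_eq0 z : sqmod z = 0 -> z = 0.
Proof. by move/eqP; rewrite sqrf_eq0 => /eqP /Normc.eq0_normc. Qed.

Lemma sqmod_parallelogram z w :
  sqmod (z + w) + sqmod (z - w) = 2 * sqmod z + 2 * sqmod w.
Proof. by case: z w => [a b] [c d]; rewrite !sqmodE; ring. Qed.

Lemma sqmod2 : sqmod 2 = 4.
Proof.
have := sqmod_parallelogram 1 1.
by rewrite subrr sqmod0 sqmod1 addr0 => ->; lra.
Qed.

Lemma sqmodD_le z w : sqmod (z + w) <= 2 * sqmod z + 2 * sqmod w.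
Proof. by rewrite -sqmod_parallelogram lerDl sqmod_ge0. Qed.

Lemma ell2_sum_le (f : X -> R[i]) (M : R) :
  (forall s, uniq s -> \sum_(x <- s) sqmod (f x) <= M) ->
  (ell2_sum f <= M%:E)%E.
Proof.
move=> fM; apply: ge_ereal_sup => _ [F [finF _] <-].
rewrite fsbig_finite//= sumEFin lee_fin; apply: fM; exact: fset_uniq.
Qed.

Definition sqnorm f : R := fine (ell2_sum f).

Lemma ell2_sumE f : ell2_sum f = (sqnorm f)%:E.
Proof.
rewrite /sqnorm fineK// ge0_fin_numE ?ell2_sum_ge0//.
by case: f => f /= /asboolP.
Qed.

Lemma sqnorm_ge0 f : 0 <= sqnorm f.
Proof. by rewrite -lee_fin -ell2_sumE ell2_sum_ge0. Qed.

Lemma sqnorm_le f M :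
  (forall s, uniq s -> \sum_(x <- s) sqmod (f x) <= M) -> sqnorm f <= M.
Proof. by move=> fM; rewrite -lee_fin -ell2_sumE ell2_sum_le. Qed.

Lemma sum_le_sqnorm f s : uniq s -> \sum_(x <- s) sqmod (f x) <= sqnorm f.
Proof.
move=> us; rewrite -lee_fin -ell2_sumE; apply: esum_ge.
exists [set` s]; first by split=> //; exact: finite_seq.
rewrite -fsbig_seq//.
by rewrite sumEFin.
Qed.

Lemma sqmod_le_sqnorm f x : sqmod (f x) <= sqnorm f.
Proof. by have := @sum_le_sqnorm f [:: x] isT; rewrite big_seq1. Qed.

Lemma sqnorm_approx f (e : R) : 0 < e ->
  exists2 s, uniq s & sqnorm f - e < \sum_(x <- s) sqmod (f x).
Proof.
move=> e0; apply: contrapT => nex.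
suff : sqnorm f <= sqnorm f - e by rewrite lerBrDr gerDl leNgt e0.
apply: sqnorm_le => s us; rewrite leNgt; apply/negP => lt.
by apply: nex; exists s.
Qed.

Lemma sqnormZ (c : R[i]) f : sqnorm (c *: f) = sqmod c * sqnorm f.
Proof.
apply/EFin_inj; rewrite -ell2_sumE EFinM -ell2_sumE.
exact: (ell2_sumZ c (f : X -> R[i])).
Qed.

(** Finite partial sums give only [le1]; the reverse is [le1] at [f + g] and [f - g], whose sum and
    difference are [2 f] and [2 g]. *)
Lemma sqnorm_parallelogram f g :
  sqnorm (f + g) + sqnorm (f - g) = 2 * sqnorm f + 2 * sqnorm g.
Proof.
have le1 (u v : ell2 R X) :
    sqnorm (u + v) + sqnorm (u - v) <= 2 * sqnorm u + 2 * sqnorm v.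
  rewrite -lee_fin !EFinD !EFinM -!ell2_sumE -esumD; last 2 first.
  - by move=> x _; rewrite lee_fin sqr_ge0.
  - by move=> x _; rewrite lee_fin sqr_ge0.
  rewrite !ell2_sumE -!EFinM -EFinD.
  apply: ge_ereal_sup => _ [F [finF _] <-].
  rewrite fsbig_finite//=; under eq_bigr do rewrite -EFinD.
  rewrite sumEFin lee_fin.
  under eq_bigr do rewrite -/(sqmod _) -/(sqmod _) sqmod_parallelogram.
  by rewrite big_split /= -!mulr_sumr lerD// ler_pM2l// sum_le_sqnorm// fset_uniq.
apply/eqP; rewrite eq_le le1 /=.
have := le1 (f + g) (f - g).
have -> : f + g + (f - g) = (2 : R[i]) *: f.
  by rewrite addrACA subrr addr0 scaler_nat mulr2n.
have -> : f + g - (f - g) = (2 : R[i]) *: g.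
  by rewrite opprB [LHS]addrC addrA subrK scaler_nat mulr2n.
rewrite !sqnormZ sqmod2; lra.
Qed.

End Ell2Vectors.

Lemma sum_if_eq (V : nmodType) (I : eqType) (s : seq I) (i : I) (c : V) :
  uniq s -> \sum_(j <- s) (if j == i then c else 0) = if i \in s then c else 0.
Proof.
move=> us; rewrite -big_mkcond; case: ifPn => si.
  by rewrite -big_filter filter_pred1_uniq// big_seq1.
by rewrite big_seq_cond big1// => j /andP[js /eqP ji]; rewrite -ji js in si.
Qed.

(** * Point masses and their density *)

Section Ell2Delta.
Variables (R : realType) (X : choiceType).
Implicit Types (f g : ell2 R X) (s t : seq X) (x y : X).

Lemma closed_sqnorm (W : set (ell2 R X)) f : closed W ->
  (forall e : R, 0 < e -> exists2 w, W w & sqnorm (f - w) < e) -> W f.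
Proof.
move=> cW Wf; apply: cW => B /nbhs_ballP[e /= e0 Be].
(* The norm takes values in [R[i]], so a radius is complex; being positive, it is its own real
   part. *)
have ei : (complex.Re e)%:C%C = e by rewrite RRe_real// gtr0_real.
have re0 : 0 < complex.Re e by move: e0; rewrite -ei ltcR.
have [w Ww fw] := Wf _ (exprn_gt0 2 re0).
exists w; split => //; apply: Be; rewrite -ball_normE /=.
rewrite ell2_normE /ell2_norm -/(sqnorm _) -ei ltcR.
by rewrite -(ltr_pXn2r (n := 2))// ?nnegrE ?sqrtr_ge0 ?ltW// sqr_sqrtr// sqnorm_ge0.
Qed.

(** Otherwise more than [sqnorm f / e] points of [S] would each carry mass at least [e]. *)
Lemma infinite_set_small f (S : set X) (e : R) : infinite_set S -> 0 < e ->
  exists2 x, S x & sqmod (f x) < e.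
Proof.
move=> infS e0; apply: contrapT => nex.
have big x : S x -> e <= sqmod (f x).
  by move=> Sx; rewrite leNgt; apply/negP => lt; apply: nex; exists x.
have [N Nf] : exists N : nat, sqnorm f < e * N%:R.
  exists (Num.truncn (sqnorm f / e)).+1.
  by rewrite mulrC -ltr_pdivrMr//; exact: truncnS_gt.
have [A AS AN] := infinite_set_fset N infS.
suff : e * N%:R <= sqnorm f by rewrite leNgt Nf.
apply: (le_trans _ (sum_le_sqnorm f (fset_uniq A))).
apply: (@le_trans _ _ (\sum_(x <- A) e)).
  by rewrite big_const_seq count_predT iter_addr_0 -[e *+ _]mulr_natr ler_pM2l// ler_nat.
by rewrite big_seq [leRHS]big_seq; apply: ler_sum => x xA; apply: big; exact: AS.
Qed.

Definition delta_fun x : X -> R[i] := fun y => (y == x)%:R.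

Lemma delta_subproof x : delta_fun x \in @ell2_pred R X.
Proof.
apply/asboolP; apply: (@le_lt_trans _ _ 1%:E); last exact: ltry.
apply: ell2_sum_le => s us.
rewrite (eq_bigr (fun y => if y == x then 1 else 0)); last first.
  by move=> y _; rewrite /delta_fun; case: eqP => _; rewrite ?sqmod1 ?sqmod0.
by rewrite sum_if_eq//; case: ifP.
Qed.

Definition delta x : ell2 R X := Ell2 (delta_subproof x).

Lemma deltaE x y : delta x y = (y == x)%:R. Proof. by []. Qed.

Lemma ell2BE f g y : (f - g) y = f y - g y. Proof. by []. Qed.
Lemma ell2DE f g y : (f + g) y = f y + g y. Proof. by []. Qed.
Lemma ell2ZE (c : R[i]) f y : (c *: f) y = c * f y. Proof. by []. Qed.

Lemma ell2_fun_sum (I : Type) (r : seq I) (F : I -> ell2 R X) y :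
  (\sum_(i <- r) F i : ell2 R X) y = \sum_(i <- r) F i y.
Proof. by elim/big_rec2: _ => // i a b _ <-. Qed.

(** The remainder is [f] off [s], so its partial sums and the sum over [s] combine into one
    duplicate-free partial sum of [f]. *)
Lemma sqnorm_truncate f s : uniq s ->
  sqnorm (f - \sum_(x <- s) f x *: delta x)
    <= sqnorm f - \sum_(x <- s) sqmod (f x).
Proof.
move=> us; apply: sqnorm_le => t ut.
have valE y : (f - \sum_(x <- s) f x *: delta x) y = if y \in s then 0 else f y.
  rewrite ell2BE ell2_fun_sum.
  rewrite (eq_bigr (fun x => if x == y then f y else 0)); last first.
    move=> x _; rewrite ell2ZE deltaE eq_sym.
    by case: eqP => [->|]; rewrite ?mulr1 ?mulr0.
  by rewrite sum_if_eq//; case: ifP => _; rewrite ?subrr ?subr0.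
rewrite lerBrDr (eq_bigr (fun y => if y \notin s then sqmod (f y) else 0)); last first.
  by move=> y _; rewrite valE; case: (y \in s); rewrite ?sqmod0.
rewrite -big_mkcond -big_filter -big_cat; apply: sum_le_sqnorm.
rewrite cat_uniq filter_uniq// us andbT; apply/hasPn => y ys.
by rewrite mem_filter ys.
Qed.

Lemma delta_dense (W : set (ell2 R X)) :
  GRing.submod_closed [pred v | v \in W] -> closed W ->
  (forall x, W (delta x)) -> W = [set: ell2 R X].
Proof.
move=> [W0 WD] cW Wd; apply/seteqP; split=> // f _.
apply: closed_sqnorm => // e e0.
have [s us se] := sqnorm_approx f e0.
exists (\sum_(x <- s) f x *: delta x); last first.
  by apply: le_lt_trans (sqnorm_truncate f us) _; rewrite ltrBlDr -ltrBlDl.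
elim: s {us se} => [|x s IH]; first by rewrite big_nil; exact: set_mem W0.
by rewrite big_cons; apply: set_mem; apply: WD; apply: mem_set.
Qed.

End Ell2Delta.

(** * Quasi-regular representations *)

Section Cosets.
Variables (gT : groupType) (H : groupClosed gT).
Implicit Types (g h : gT) (A : coset_space H).

Lemma left_coset_subproof g : left_coset H g \in range (left_coset H).
Proof. by apply/mem_set; exists g. Qed.

Definition mk_coset g : coset_space H := exist _ (left_coset H g) (left_coset_subproof g).

Lemma mk_cosetP A : exists g, A = mk_coset g.
Proof.
case: A => A pA; have [g _ gA] := set_mem pA.
by exists g; apply: val_inj => /=; rewrite gA.
Qed.

Lemma coset_act_mk g h : coset_act g (mk_coset h) = mk_coset (g * h)%g.
Proof.
apply/val_inj/seteqP; split => [_ [_ [k Hk <-] <-]|_ [k Hk <-]] /=.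
  by exists k; rewrite ?mulgA.
by exists (h * k)%g; rewrite ?mulgA//; exists k.
Qed.

Lemma mk_coset_id h : h \in H -> mk_coset h = mk_coset 1%g.
Proof.
move=> Hh; apply/val_inj/seteqP; split => [_ [k Hk <-]|_ [k Hk <-]] /=.
  by exists (h * k)%g; rewrite ?mul1g//; exact: gpredM.
exists (h^-1 * k)%g; first by apply: gpredM => //; rewrite gpredV.
by rewrite mulVKg mul1g.
Qed.

Definition coset_orbit (K : groupClosed gT) A : set (coset_space H) :=
  [set coset_act k A | k in [set` K]].

End Cosets.

(** * Mackey's criterion for irreducibility and inequivalence *)

Section Mackey.
Variables (R : realType) (gT : groupType).

Lemma quasi_regularE (H : groupClosed gT) g (f : ell2 R (coset_space H)) A :
  quasi_regular R H g f A = f (coset_act g^-1 A).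
Proof. by []. Qed.

Lemma sqnorm_quasi_regular (H : groupClosed gT) g (f : ell2 R (coset_space H)) :
  sqnorm (quasi_regular R H g f) = sqnorm f.
Proof. by apply/EFin_inj; rewrite -!ell2_sumE; exact: quasi_regular_sum. Qed.

Lemma quasi_regular_delta (H : groupClosed gT) g A :
  quasi_regular R H g (delta R A) = delta R (coset_act g A).
Proof.
apply/val_inj/funext => B /=; rewrite /delta_fun; congr (nat_of_bool _)%:R.
apply/eqP/eqP => [<-|->]; rewrite -coset_actM ?mulgV ?mulVg coset_act1//.
Qed.

Section Irreducible.
Variable H : groupClosed gT.
Hypothesis infH : forall A, A <> mk_coset H 1%g -> infinite_set (coset_orbit H A).
Local Notation o := (mk_coset H 1%g).
Local Notation V := (ell2 R (coset_space H)).
Local Notation rho := (quasi_regular R H).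

Section Invariant.
Variable W : set V.
Hypothesis Wsub : GRing.submod_closed [pred v | v \in W].
Hypothesis Wcl : closed W.
Hypothesis Winv : forall g v, W v -> W (rho g v).

Let C : set V := [set v | W v /\ v o = 1].

Lemma submodD v w : W v -> W w -> W (v + w).
Proof.
move=> Wv Ww; rewrite -[v]scale1r; apply: set_mem.
by apply: (proj2 Wsub); apply: mem_set.
Qed.

Lemma submodZ c v : W v -> W (c *: v).
Proof.
move=> Wv; rewrite -[_ *: _]addr0; apply: set_mem.
by apply: (proj2 Wsub) => //; [exact: mem_set | exact: (proj1 Wsub)].
Qed.

(** The midpoint of [v] and [w] lies in [C], so [sqnorm (v + w)] is at least [4 * m], and the
    parallelogram identity leaves at most [4 * e] for [v - w]. *)
Lemma normalized_near (m e : R) v w : (forall u, C u -> m <= sqnorm u) ->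
  C v -> C w -> sqnorm v <= m + e -> sqnorm w <= m + e ->
  sqnorm (v - w) <= 4 * e.
Proof.
move=> mC [Wv v1] [Ww w1] ve we.
have hh : sqmod (2^-1 : R[i]) = 4^-1.
  apply: (@mulIf _ 4) => //; rewrite mulVf//.
  by rewrite -(sqmod2 R) -sqmodM mulVf ?sqmod1// pnatr_eq0.
have Cu : C (2^-1 *: (v + w)).
  split; first by apply: submodZ; exact: submodD.
  by rewrite ell2ZE ell2DE v1 w1 mulVf// pnatr_eq0.
have := mC _ Cu; rewrite sqnormZ hh.
by have := sqnorm_parallelogram v w; lra.
Qed.

Lemma delta_in_W v0 : W v0 -> v0 o = 1 -> W (delta R o).
Proof.
move=> Wv0 v0o; have Cv0 : C v0 by []; pose Q := [set sqnorm v | v in C].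
have Q0 : Q !=set0 by exists (sqnorm v0); exists v0.
have Qlb : lbound Q 0 by move=> _ [v _ <-]; exact: sqnorm_ge0.
have Qinf : has_inf Q by split=> //; exists 0.
have mC u : C u -> inf Q <= sqnorm u.
  by move=> Cu; apply: ge_inf; [exists 0 | exists u].
have nearinf (e : R) : 0 < e -> exists2 v, C v & sqnorm v <= inf Q + e.
  by move=> e0; have [_ [v Cv <-] /ltW ve] := inf_adherent e0 Qinf; exists v.
have small (e : R) v A : 0 < e -> C v -> sqnorm v <= inf Q + e ->
    sqmod (v A - delta R o A) <= 10 * e.
  move=> e0 Cv ve; rewrite deltaE; case: eqP => [->|Ao].
    by rewrite (proj2 Cv) subrr sqmod0; lra.
  rewrite subr0.
  (* Here [v] is small at [coset_act h A] and changes little under [h], so the bound is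
     [2 * (4 * e) + 2 * e]. *)
  have [_ [h Hh <-] vh] := infinite_set_small v (infH Ao) e0.
  have Ch : C (rho h^-1%g v).
    split; first by apply: Winv; exact: (proj1 Cv).
    rewrite quasi_regularE invgK coset_act_mk mulg1 mk_coset_id//.
    exact: (proj2 Cv).
  have := normalized_near mC Cv Ch ve; rewrite sqnorm_quasi_regular => /(_ ve).
  move=> /(le_trans (sqmod_le_sqnorm _ A)).
  rewrite ell2BE quasi_regularE invgK.
  set a := v A; set b := v _ => ab.
  by have := sqmodD_le (a - b) b; rewrite subrK; lra.
apply: closed_sqnorm => // e e0.
have e90 : 0 < e / 20 by lra.
have [v Cv ve] := nearinf _ e90.
exists v; first exact: (proj1 Cv).
suff : sqnorm (delta R o - v) <= 9 * (e / 20) by lra.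
apply: sqnorm_le => s us.
(* [v] is chosen before [s], so [small] cannot be summed over [s] for [v] itself. A second vector
   [w], nearer the infimum as [s] grows, contributes at most [e / 20] over [s], and [v - w] at most
   [8 * (e / 20)]. *)
pose e' : R := Num.min (e / 20) (e / 20 / (20 * (size s).+1%:R)).
have e'0 : 0 < e' by rewrite lt_min e90 divr_gt0// mulr_gt0.
have [w Cw we] := nearinf _ e'0.
have e'e : e' <= e / 20 by rewrite ge_min lexx.
have we' : sqnorm w <= inf Q + e / 20 by lra.
have vw := normalized_near mC Cv Cw ve we'.
apply: (@le_trans _ _ (\sum_(x <- s) (2 * sqmod ((v - w) x) + 20 * e'))).
  apply: ler_sum => A _.
  have := small _ _ A e'0 Cw we.
  rewrite !ell2BE.
  set a := v A; set b := w A; set c := delta R o A => bc.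
  have := sqmodD_le (a - b) (b - c).
  rewrite addrA subrK -sqmodN opprB.
  lra.
rewrite big_split /= -mulr_sumr big_const_seq count_predT iter_addr_0.
have := sum_le_sqnorm (v - w) us.
suff : (20 * e') *+ size s <= e / 20 by lra.
have : e' <= e / 20 / (20 * (size s).+1%:R) by rewrite ge_min lexx orbT.
rewrite ler_pdivlMr; last by rewrite mulr_gt0.
apply: le_trans; rewrite -[leLHS]mulr_natr -natr1 -subr_ge0.
by rewrite [leRHS](_ : _ = 20 * e'); [rewrite mulr_ge0// ltW | ring].
Qed.

End Invariant.

Lemma quasi_regular_irreducible : irreducible rho.
Proof.
split.
  exists (delta R o); apply/eqP => /(congr1 (fun f : V => f o)).
  by rewrite deltaE eqxx => /eqP; rewrite oner_eq0.
move=> W Wsub Wcl Winv.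
have [[w Ww w0]|W0] := pselect (exists2 w, W w & w <> 0); last first.
  left; apply/seteqP; split => [v Wv|_ ->]; last exact: set_mem (proj1 Wsub).
  by apply: contrapT => v0; apply: W0; exists v.
right; apply: delta_dense => // A.
have [B wB] : exists B, w B != 0.
  apply: contrapT => nex; apply: w0; apply/val_inj/funext => B.
  by apply: contrapT => /eqP wB; apply: nex; exists B.
have [b Bb] := mk_cosetP B; have [a ->] := mk_cosetP A.
(* Transitivity leaves only the base point; moving [B] there by [b^-1] and dividing by [w B] gives a
   vector with value 1. *)
rewrite -[a]mulg1 -coset_act_mk -quasi_regular_delta; apply: (Winv).
apply: (@delta_in_W W _ _ _ ((w B)^-1 *: rho b^-1%g w)) => //.
  by apply: submodZ => //; exact: Winv.
rewrite ell2ZE quasi_regularE invgK coset_act_mk mulg1 -Bb.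
by rewrite mulVf.
Qed.

End Irreducible.

Lemma quasi_regular_inequivalent (H K : groupClosed gT) :
  (forall A : coset_space K, infinite_set (coset_orbit H A)) ->
  ~ unitarily_equivalent (quasi_regular R H) (quasi_regular R K).
Proof.
move=> infHK [U [Unorm _ Urho]].
set o := mk_coset H 1%g; pose u := U (delta R o).
have uinv h : h \in H -> quasi_regular R K h u = u.
  by move=> Hh; rewrite /u -Urho quasi_regular_delta coset_act_mk mulg1 mk_coset_id.
have u0 : u = 0.
  apply/val_inj/funext => A; apply: sqmod_eq0; apply/eqP.
  rewrite eq_le sqmod_ge0 andbT leNgt; apply/negP => uA.
  (* The threshold is [sqmod (u A)] itself, yet [u] has the value [u A] along the whole orbit. *)
  have [_ [h Hh <-]] := infinite_set_small u (infHK A) uA.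
  have <- := congr1 (fun f : ell2 R _ => f (coset_act h A)) (uinv h Hh).
  by rewrite quasi_regularE -coset_actM mulVg coset_act1 ltxx.
have : `|delta R o| = 0 by rewrite -Unorm -/u u0 normr0.
move=> /normr0_eq0 /(congr1 (fun f : ell2 R _ => f o)).
by rewrite deltaE eqxx => /eqP; rewrite oner_eq0.
Qed.

End Mackey.

Local Close Scope ring_scope.

(** * Automorphisms of the rooted tree *)

Section TreeAut.
Variable d : nat.
Implicit Types (g h : tree_aut d) (s t u : seq 'I_d).

Lemma tree_aut_inj g : injective g.
Proof. exact: can_inj (tree_aut_funK g). Qed.

Lemma mulgE g h s : (g * h)%g s = g (h s). Proof. by []. Qed.
Lemma mulVgE g s : (g^-1)%g (g s) = s. Proof. exact: tree_aut_funK. Qed.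
Lemma mulgVE g s : g ((g^-1)%g s) = s. Proof. exact: tree_aut_invK. Qed.

Lemma tree_aut_rcons g s x : exists y, g (rcons s x) = rcons (g s) y.
Proof.
have [_ _ gc] := tree_autP g.
have : is_child (g s) (g (rcons s x)) by rewrite gc; apply/existsP; exists x.
by case/existsP => y /eqP ->; exists y.
Qed.

Lemma tree_aut_cat g s t : exists2 u, g (s ++ t) = g s ++ u & size u = size t.
Proof.
elim/last_ind: t => [|t x [u gu su]]; first by exists [::]; rewrite ?cats0.
have [y] := tree_aut_rcons g (s ++ t) x.
rewrite -rcons_cat gu => ->; exists (rcons u y); first by rewrite rcons_cat.
by rewrite !size_rcons su.
Qed.

Lemma size_tree_aut g s : size (g s) = size s.
Proof.
have [_ g0 _] := tree_autP g.
by have [u /= ->] := tree_aut_cat g [::] s; rewrite g0.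
Qed.

Lemma take_tree_aut g n s : g (take n s) = take n (g s).
Proof.
have [le|lt] := leqP (size s) n; first by rewrite !take_oversize ?size_tree_aut.
have [u gu _] := tree_aut_cat g (take n s) (drop n s).
move: gu; rewrite cat_take_drop => ->.
by rewrite take_size_cat// size_tree_aut size_takel// ltnW.
Qed.

Lemma is_child_cat s t u : is_child (s ++ t) (s ++ u) = is_child t u.
Proof.
by apply: eq_existsb => x; rewrite rcons_cat eqseq_cat ?eqxx.
Qed.

Lemma tree_aut_stab_cat g s t :
  g s = s -> g (s ++ t) = s ++ drop (size s) (g (s ++ t)).
Proof.
by move=> gs; have [u -> _] := tree_aut_cat g s t; rewrite gs drop_size_cat.
Qed.

Lemma section_exists g s : g s = s -> exists h, is_section g s h.
Proof.
move=> gs; pose sec (k : tree_aut d) t := drop (size s) (k (s ++ t)).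
have gVs : (g^-1)%g s = s by rewrite -[in LHS]gs mulVgE.
have secE (k : tree_aut d) t : k s = s -> k (s ++ t) = s ++ sec k t.
  by move=> ks; exact: tree_aut_stab_cat.
have [_ _ gc] := tree_autP g.
have aut : `[< tree_automorphism (sec g) >].
  apply/asboolP; split.
  - exists (sec g^-1%g) => t.
      by rewrite /sec -secE// mulVgE drop_size_cat.
    by rewrite {1}/sec -secE// mulgVE drop_size_cat.
  - by rewrite /sec cats0 gs drop_size.
  - by move=> t u; rewrite -(is_child_cat s) -!secE// gc is_child_cat.
by exists (TreeAut aut) => t; exact: secE.
Qed.

End TreeAut.

(** * Growth of the orbits of rigid stabilizers on the levels *)

Section Growth.
Variables (d : nat) (G : groupClosed (tree_aut d)).
Implicit Types (g h k : tree_aut d) (s t u v w : seq 'I_d).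

(* The group [K] with [Rist_G(s) = { k^s : k in K }]. *)
Definition rist_base s : set (tree_aut d) :=
  [set k | k \in G /\ exists2 h, h \in G & h =1 graft s k].

Lemma graft_cat s k t : graft s k (s ++ t) = s ++ k t.
Proof. by rewrite /graft prefix_prefix drop_size_cat. Qed.

Lemma graft_id s k t : ~~ prefix s t -> graft s k t = t.
Proof. by rewrite /graft => /negbTE ->. Qed.

Lemma rist_base1 s : rist_base s 1%g.
Proof.
split; first exact: gpred1.
exists 1%g; first exact: gpred1.
move=> t; have [/prefixP[u ->]|st] := boolP (prefix s t).
  by rewrite graft_cat.
by rewrite graft_id.
Qed.

Hypothesis G_transitive : spherically_transitive G.
Hypothesis G_fractal : fractal G.
Hypothesis G_weakly_branch : weakly_branch G.

(** By fractality [g] is the section at [s] of some [a] in [G]; conjugating the graft of [k] by [a]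
    gives the graft of [g * k * g^-1], since [a] preserves the subtree below [s] and its
    complement. *)
Lemma rist_baseJ s k g : g \in G -> rist_base s k -> rist_base s (g * k * g^-1)%g.
Proof.
move=> gG [kG [h hG hE]]; split; first by rewrite !gpredM// gpredV.
have [a [aG as_] aE] : [set h | exists2 g, vertex_stab G s g & is_section g s h] g.
  by rewrite G_fractal.
exists (a * h * a^-1)%g; first by rewrite !gpredM// gpredV.
move=> t; rewrite !mulgE hE; have [/prefixP[u ->]|st] := boolP (prefix s t).
  have -> : (a^-1)%g (s ++ u) = s ++ (g^-1)%g u.
    by apply: (@tree_aut_inj _ a); rewrite mulgVE aE mulgVE.
  by rewrite !graft_cat aE.
rewrite !graft_id ?mulgVE//; apply: contra st => /prefixP[u au].
by rewrite -(mulgVE a t) au aE prefix_prefix.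
Qed.

(** A nontrivial [h] in the rigid stabilizer of [s ++ t] is also the graft at [s] of its section
    [k], and fractality puts [k] in [G]. *)
Lemma rist_base_moves_below s t :
  exists2 k, rist_base s k & k t = t /\ exists u, k (t ++ u) <> t ++ u.
Proof.
have [h [[hG [k' k'G hE]] h1]] : exists h, rigid_stab G (s ++ t) h /\ h <> 1%g.
  apply: contrapT => nex; apply: (G_weakly_branch (s := s ++ t)).
  apply: (@sub_finite_set _ _ [set 1%g]) => [h hr|]; last exact: finite_set1.
  by apply: contrapT => h1; apply: nex; exists h.
have hcat u : h (s ++ t ++ u) = s ++ t ++ k' u by rewrite catA hE graft_cat catA.
(* [h] fixes [s], which lies outside the subtree at [s ++ t], or is its root if [t] is empty. *)
have nst : ~~ prefix (s ++ t) s \/ t = [::].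
  case: t {hE hcat} => [|x t]; [by right|left].
  by apply/negP => /size_prefix; rewrite size_cat /= addnS ltnNge leq_addr.
have [_ k0 _] := tree_autP k'.
have hs : h s = s.
  case: nst => [nst|t0]; first by rewrite hE graft_id.
  by have := hcat [::]; rewrite k0 t0 !cats0.
have [k kE] := section_exists hs.
have kG : k \in G.
  have : [set` G] k by rewrite -(G_fractal s); exists h.
  by [].
have kcat u : k (t ++ u) = t ++ k' u.
  by have /eqP := kE (t ++ u); rewrite hcat eqseq_cat// => /andP[_ /eqP].
exists k.
  split => //; exists h => // u; have [/prefixP[v ->]|su] := boolP (prefix s u).
    by rewrite graft_cat kE.
  rewrite graft_id// hE graft_id//; apply: contra su => /prefixP[v ->].
  by rewrite -catA prefix_prefix.
split; first by have := kcat [::]; rewrite k0 cats0.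
apply: contrapT => nex; apply: h1; apply/val_inj/funext => v /=.
rewrite hE; have [/prefixP[u ->]|su] := boolP (prefix (s ++ t) v).
  rewrite graft_cat -!catA -kcat.
  by apply: contrapT => ne; apply: nex; exists u => e; apply: ne; rewrite e.
by rewrite graft_id.
Qed.

Definition orbit_ge s v N := exists r : seq (seq 'I_d),
  [/\ uniq r, size r = N & forall w, w \in r -> exists2 k, rist_base s k & w = k v].

(** Induction on [N]: the orbit of [t ++ u] has a point above each point of the orbit of [t], and
    two above [t] itself if some [k] fixes [t] and moves [t ++ u]. Normality of [rist_base s] and
    transitivity of [G] spread the count over the level. *)
Lemma level_orbit_ge s N : exists n, forall v, size v = n -> orbit_ge s v N.
Proof.
elim: N => [|N [n IH]]; first by exists 0%N => v _; exists [::].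
have [x _] : exists x : 'I_d, True.
  have [k _ [_ [[|x u]]]] := rist_base_moves_below s [::]; last by exists x.
  by have [_ -> _] := tree_autP k.
pose t := nseq n x.
have tn : size t = n by rewrite size_nseq.
have [r [ur sr rE]] := IH t tn.
have [k Kk [kt [u ku]]] := rist_base_moves_below s t.
exists (n + size u)%N => v sv.
pose w0 := t ++ u.
have [y yG yv] : exists2 y, y \in G & y w0 = v.
  have sw : size w0 == (n + size u)%N by rewrite size_cat tn.
  by have [y yG] := G_transitive (Tuple sw) (Tuple (introT eqP sv)); exists y.
suff [r' [ur' sr' r'E]] : orbit_ge s w0 N.+1.
  exists (map y r'); split; rewrite ?size_map//.
    by rewrite map_inj_uniq//; exact: tree_aut_inj.
  move=> w /mapP[w' /r'E[a Ka ->] ->]; exists (y * a * y^-1)%g.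
    exact: rist_baseJ.
  by rewrite -yv !mulgE mulVgE.
(* One orbit point above each [w] in [r]; the value [[::]] elsewhere is a dummy. *)
have lift w : exists w', w \in r -> take n w' = w /\
    exists2 a, rist_base s a & w' = a w0.
  have [/rE[a Ka ->]|wr] := boolP (w \in r); last by exists [::].
  exists (a w0) => _; split; last by exists a.
  by rewrite -take_tree_aut take_size_cat.
have [f fE] := choice lift.
have fr : {in r &, injective f}.
  move=> a b ar br fab; have [<- _] := fE a ar; have [<- _] := fE b br.
  by rewrite fab.
(* [w0] and [k w0] both lie above [t], so [f] misses one of them on [r]. *)
have [z zr [a Ka za]] : exists2 z, z \notin map f r &
    exists2 a, rist_base s a & z = a w0.
  have [w0r|w0r] := boolP (w0 \in map f r); last first.
    by exists w0 => //; exists 1%g => //; exact: rist_base1.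
  exists (k w0); last by exists k.
  apply/negP => kr; apply: ku; rewrite -/w0.
  case/mapP: w0r => b br w0b; case/mapP: kr => c cr kc.
  have [tb _] := fE b br; have [tc _] := fE c cr.
  rewrite kc w0b; congr f; rewrite -tb -tc -kc -w0b -take_tree_aut.
  by rewrite take_size_cat.
exists (z :: map f r); split.
- by rewrite /= zr map_inj_in_uniq.
- by rewrite /= size_map sr.
- move=> w; rewrite inE => /orP[/eqP ->|/mapP[b br ->]]; first by exists a.
  by have [_ []] := fE b br => c Kc ->; exists c.
Qed.

End Growth.

(** * Rays and parabolic subgroups *)

Section Rays.
Variables (d : nat) (G : groupClosed (tree_aut d)).
Implicit Types (g h k : tree_aut d) (e : nat -> 'I_d).

Lemma take_ray e m n : m <= n -> take m (mkseq e n) = mkseq e m.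
Proof.
by move=> mn; rewrite /mkseq -map_take take_iota (minn_idPl mn).
Qed.

Definition ray_equiv e1 e2 : Prop :=
  exists2 g, g \in G & forall n, g (mkseq e1 n) = mkseq e2 n.

Lemma ray_equiv_refl e : ray_equiv e e.
Proof. by exists 1%g => //; exact: gpred1. Qed.

Lemma ray_equiv_sym e1 e2 : ray_equiv e1 e2 -> ray_equiv e2 e1.
Proof.
move=> [g gG ge]; exists (g^-1)%g; first by rewrite gpredV.
by move=> n; rewrite -ge mulVgE.
Qed.

Lemma ray_equiv_trans e1 e2 e3 :
  ray_equiv e1 e2 -> ray_equiv e2 e3 -> ray_equiv e1 e3.
Proof.
move=> [g gG ge] [h hG he]; exists (h * g)%g; first exact: gpredM.
by move=> n; rewrite mulgE ge he.
Qed.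

Lemma ray_class_countable e : countable [set` G] -> countable [set e' | ray_equiv e e'].
Proof.
move=> cG; pose a := e 0.
(* Letter [n] of the image ray is the last one of its prefix of length [n.+1], so the default [a] is
   never read. *)
pose move g n := nth a (g (mkseq e n.+1)) n.
apply: (@sub_countable _ _ _ [set move g | g in [set` G]]); last first.
  exact: sub_countable (card_image_le _ _) cG.
apply: subset_card_le => e' [g gG ge]; exists g => //.
by apply/funext => n; rewrite /move ge nth_mkseq.
Qed.

Lemma uncountable_rays (a b : 'I_d) : a <> b -> ~ countable [set: nat -> 'I_d].
Proof.
move=> ab /countable_injP[i /in2TT iinj].
(* Cantor's diagonal: [D] differs at [n] from the ray that [i] sends to [n], if there is one. *)
pose D n := if `[< exists2 e, i e = n & e n = a >] then b else a.
have [Da|Da] := pselect (D (i D) = a).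
  have : D (i D) = b by rewrite {1}/D; case: asboolP => // nex; case: nex; exists D.
  by rewrite Da.
apply: (Da); rewrite /D; case: asboolP => // -[e eD ea].
by case: Da; have <- : e = D by [exact: iinj]; rewrite eD.
Qed.

Section Representatives.
Variable e0 : nat -> 'I_d.

(** Choosing from the class as a set makes the choice constant on it; the default [e0] is never
    returned. *)
Definition ray_repr e : nat -> 'I_d := xget e0 [set e' | ray_equiv e e'].

Lemma ray_reprP e : ray_equiv e (ray_repr e).
Proof. exact: (@xgetI _ e0 [set e' | ray_equiv e e'] e (ray_equiv_refl e)). Qed.

Lemma ray_repr_eq e1 e2 : ray_equiv e1 e2 -> ray_repr e1 = ray_repr e2.
Proof.
move=> e12; rewrite /ray_repr; congr xget; apply/seteqP; split => e /=.
  exact/ray_equiv_trans/ray_equiv_sym.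
exact: ray_equiv_trans.
Qed.

Lemma ray_repr_inj e1 e2 : range ray_repr e1 -> range ray_repr e2 ->
  ray_equiv e1 e2 -> e1 = e2.
Proof.
move=> [f1 _ <-] [f2 _ <-] f12; apply: ray_repr_eq.
apply: ray_equiv_trans (ray_reprP f1) _; apply: ray_equiv_trans f12 _.
exact/ray_equiv_sym/ray_reprP.
Qed.

(** Otherwise countably many countable classes would cover all rays. *)
Lemma uncountable_ray_repr (a b : 'I_d) : a <> b -> countable [set` G] ->
  ~ countable (range ray_repr).
Proof.
move=> ab cG cE; apply: (uncountable_rays ab).
apply: (@sub_countable _ _ _ (\bigcup_(e in range ray_repr) [set e' | ray_equiv e e'])).
  apply: subset_card_le => e _; exists (ray_repr e); first by exists e.
  exact/ray_equiv_sym/ray_reprP.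
by apply: bigcup_countable => // e _; exact: ray_class_countable.
Qed.

End Representatives.
End Rays.

(** * Orbits of parabolic subgroups on the cosets of parabolic subgroups *)

Section Parabolic.
Variables (d : nat) (G : groupClosed (tree_aut d)).
Hypothesis G_transitive : spherically_transitive G.
Hypothesis G_fractal : fractal G.
Hypothesis G_weakly_branch : weakly_branch G.
Implicit Types (e : nat -> 'I_d) (g h : subgroup_type G).

Lemma parabolicP e g :
  reflect (forall n, (val g : tree_aut d) (mkseq e n) = mkseq e n) (g \in parabolic G e).
Proof. exact: asboolP. Qed.

(** The prefix of length [n] of the ray [g e] attached to a coset [g P]; any representative gives
    the same, as [P] fixes [e]. *)
Definition coset_vertex e n (A : coset_space (parabolic G e)) : seq 'I_d :=
  (val (xget 1%g (val A)) : tree_aut d) (mkseq e n).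

Lemma coset_vertexE e n g :
  coset_vertex n (mk_coset (parabolic G e) g) = (val g : tree_aut d) (mkseq e n).
Proof.
rewrite /coset_vertex; set A := val (mk_coset _ _).
have : A (xget 1%g A) by apply: (@xgetI _ _ A g); exists 1%g; rewrite ?mulg1//; exact: gpred1.
by case=> p /parabolicP pe <-; rewrite /= pe.
Qed.

(** A finite orbit [cs] would give at most [size cs] vertices at level [n0 + n], whereas [Rist_G(s)]
    alone produces at least one more. *)
Lemma parabolic_orbit_infinite e1 e2 g n0 :
  (val g : tree_aut d) (mkseq e2 n0) <> mkseq e1 n0 ->
  infinite_set (coset_orbit (parabolic G e1) (mk_coset (parabolic G e2) g)).
Proof.
move=> ge /finite_seqP[cs csE]; pose s := (val g : tree_aut d) (mkseq e2 n0).
have ss : size s = n0 by rewrite size_tree_aut size_mkseq.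
have [n bign] := level_orbit_ge G_transitive G_fractal G_weakly_branch s (size cs).+1.
pose f := (val g : tree_aut d) (mkseq e2 (n0 + n)).
have sfE : s ++ drop n0 f = f.
  by rewrite -[RHS](cat_take_drop n0 f) /f -take_tree_aut take_ray// leq_addr.
have [r [ur sr rE]] : orbit_ge G s (drop n0 f) (size cs).+1.
  by apply: bign; rewrite size_drop size_tree_aut size_mkseq addKn.
have sub : {subset map (cat s) r <= map (@coset_vertex e2 (n0 + n)) cs}.
  move=> _ /mapP[w /rE[k [kG [h hG hE]] ->] ->].
  pose h' : subgroup_type G := SubgroupType hG.
  have h'P : h' \in parabolic G e1.
    (* A prefix of [e1] extending [s] would make [s] itself a prefix of [e1], against [ge]; so the
       graft at [s] fixes [e1]. *)
    apply/parabolicP => m /=; rewrite hE graft_id//; apply/negP => /prefixP[u e1u].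
    apply: ge; rewrite -/s -ss.
    have nm : size s <= m by rewrite -(size_mkseq e1 m) e1u size_cat leq_addr.
    by rewrite -(take_ray e1 nm) e1u take_size_cat.
  apply/mapP; exists (coset_act h' (mk_coset (parabolic G e2) g)).
    have : coset_orbit (parabolic G e1) (mk_coset (parabolic G e2) g)
      (coset_act h' (mk_coset (parabolic G e2) g)) by exists h'.
    by rewrite csE.
  by rewrite coset_act_mk coset_vertexE /= -/f hE -[X in graft s k X]sfE graft_cat.
have := uniq_leq_size _ sub; rewrite map_inj_uniq; last first.
  by move=> a b /eqP; rewrite eqseq_cat// => /andP[_ /eqP].
by move=> /(_ ur); rewrite !size_map sr ltnn.
Qed.

End Parabolic.

Local Open Scope ring_scope.

(* "Discrete group" means countable discrete group here: the uncountable group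
   Aut(T) itself is transitive on rays, so all its parabolic subgroups are
   conjugate. *)
Theorem mainTheorem3 (R : realType) (d : nat) (G : groupClosed (tree_aut d))
    (G_countable : countable [set` G])
    (G_transitive : spherically_transitive G)
    (G_fractal : fractal G) (G_weakly_branch : weakly_branch G) :
  exists E : set (nat -> 'I_d),
    [/\ ~ countable E,
        forall e, E e -> irreducible (quasi_regular R (parabolic G e))
      & forall e1 e2, E e1 -> E e2 -> e1 <> e2 ->
          ~ unitarily_equivalent (quasi_regular R (parabolic G e1))
                                 (quasi_regular R (parabolic G e2))].
Proof.
have infP e1 e2 (g : subgroup_type G) : ~ (forall n,
    (val g : tree_aut d) (mkseq e2 n) = mkseq e1 n) ->
    infinite_set (coset_orbit (parabolic G e1) (mk_coset (parabolic G e2) g)).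
  by move=> /existsNP[n ne]; exact: parabolic_orbit_infinite ne.
(* With at most one letter, words of equal length coincide and nothing could be moved. *)
have [x0 [x1 x01]] : exists a b : 'I_d, a <> b.
  have [k _ [_ [u ku]]] :=
    rist_base_moves_below G_fractal G_weakly_branch [::] [::].
  apply: contrapT => nex; apply: ku => /=.
  have : size (k u) = size u := size_tree_aut k u.
  elim: u (k u) => [|a u IH] [|b v] //= [vu]; rewrite (IH _ vu); congr cons.
  by apply: contrapT => ba; apply: nex; exists b, a.
(* One ray per orbit of [G]; the constant ray at [x0] is only a default. *)
exists (range (ray_repr G (fun=> x0))); split.
- exact: uncountable_ray_repr x01 G_countable.
- move=> e _; apply: quasi_regular_irreducible => A.
  (* An element [g] fixing the ray [e] lies in the parabolic subgroup, so its coset is the base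
     point. *)
  have [g ->] := mk_cosetP A => gP; apply: infP => ge; apply: gP.
  by apply: mk_coset_id; apply/parabolicP.
- move=> e1 e2 Ee1 Ee2 e12; apply: quasi_regular_inequivalent => A.
  (* An element [g] carrying [e2] to [e1] would put two distinct chosen rays in one orbit. *)
  have [g ->] := mk_cosetP A; apply: infP => ge; apply: e12.
  apply/esym/(ray_repr_inj Ee2 Ee1); exists (val g) => //.
  by case: g {ge}.
Qed.
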